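(* Let $X$ be a real Banach space, let $\sum_i x_i$ be a series in $X$ and let $\theta=(k_r)$ be a lacunary sequence. The following conditions are equivalent: (1) $\sum_i x_i$ is a weakly unconditionally Cauchy series (wuC). (2) $S_{N_\theta}(\sum_i x_i)$ is a complete space (with the supremum norm). (3) $c_0\subset S_{N_\theta}(\sum_i x_i)$.
   Context: A lacunary sequence is a (strictly) increasing sequence $\theta=(k_r)_{r\ge 0}$ of natural numbers with $k_0=0$ and $h_r=k_r-k_{r-1}\to+\infty$ as $r\to\infty$. For $r\ge 1$ put $I_r=(k_{r-1},k_r]$ (the set of integers $k$ with $k_{r-1}<k\le k_r$). A sequence $(s_k)$ in $X$ is $N_\theta$-summable (lacunary strongly convergent) to $L\in X$ if $\lim_{r\to\infty}\frac{1}{h_r}\sum_{k\in I_r}\|s_k-L\|=0$. A series $\sum_i z_i$ in $X$ is $N_\theta$-summable if its sequence of partial sums $s_k=\sum_{i=1}^k z_i$ is $N_\theta$-summable to some $L\in X$. $\ell_\infty$ is the space of bounded real sequences and $c_0$ the space of real sequences converging to $0$. For a series $\sum_i x_i$ in $X$, $$S_{N_\theta}\Big(\sum_i x_i\Big)=\Big\{(a_i)_i\in\ell_\infty:\ \sum_i a_i x_i \text{ is } N_\theta\text{-summable}\Big\},$$ endowed with the supremum norm. A series $\sum_i x_i$ is weakly unconditionally Cauchy (wuC) if for every permutation $\pi$ of $\mathbb{N}$ the sequence $(\sum_{i=1}^n x_{\pi(i)})_n$ is weakly Cauchy; equivalently, $\sum_i|f(x_i)|<\infty$ for every $f\in X^*$.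 *)

(* Defs.v *)
(* Sequences are indexed from 0: the terms x 0, x 1, ... stand for x_1, x_2, ...,
   so that [series x k] = \sum_(0 <= i < k) x i is the sum of the first k terms. *)
From mathcomp Require Export all_boot all_order all_algebra.
From mathcomp Require Export all_classical all_reals all_analysis.
Export Order.TTheory GRing.Theory Num.Theory numFieldNormedType.Exports.

Set Implicit Arguments.
Unset Strict Implicit.
Unset Printing Implicit Defensive.

Local Open Scope classical_set_scope.
Local Open Scope ring_scope.

(* Only used for r >= 1; [gap theta 0] = 0 since [0.-1 = 0]. *)
Definition gap (theta : nat -> nat) (r : nat) : nat := (theta r - theta r.-1)%N.

Definition lacunary (theta : nat -> nat) : Prop :=
  [/\ theta 0%N = 0%N,
      (forall r, (theta r < theta r.+1)%N) &
      gap theta @ \oo --> \oo].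

(* The range is the set of k with theta r.-1 < k <= theta r. *)
Definition lacunary_mean (R : realType) (X : normedModType R)
    (theta : nat -> nat) (s : nat -> X) (L : X) (r : nat) : R :=
  (gap theta r)%:R^-1 *
    \sum_((theta r.-1).+1 <= k < (theta r).+1) `|s k - L|.

Definition Ntheta_lim (R : realType) (X : normedModType R)
    (theta : nat -> nat) (s : nat -> X) (L : X) : Prop :=
  lacunary_mean theta s L @ \oo --> (0 : R).

Definition Ntheta_summable_series (R : realType) (X : normedModType R)
    (theta : nat -> nat) (z : nat -> X) : Prop :=
  exists L : X, Ntheta_lim theta (series z) L.

Definition linfty (R : realType) : set (nat -> R) :=
  [set a | bounded_fun a].

Definition c0 (R : realType) : set (nat -> R) :=
  [set a | a @ \oo --> (0 : R)].

Definition S_Ntheta (R : realType) (X : normedModType R)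
    (theta : nat -> nat) (x : nat -> X) : set (nat -> R) :=
  [set a | linfty a /\ Ntheta_summable_series theta (fun i => a i *: x i)].

(* The supremum norm on [linfty]; [sup] is junk on unbounded sequences. *)
Definition sup_norm (R : realType) (a : nat -> R) : R :=
  sup (range (fun i => `|a i|)).

(* Completeness of a set of bounded sequences, as a metric space for
   the distance induced by [sup_norm]. *)
Definition sup_norm_complete (R : realType) (S : set (nat -> R)) : Prop :=
  forall u : nat -> (nat -> R), (forall n, S (u n)) ->
    (forall e : R, 0 < e -> exists N : nat, forall m n : nat,
       (N <= m)%N -> (N <= n)%N -> sup_norm (u m \- u n) < e) ->
    exists2 a : nat -> R, S a &
      (fun n => sup_norm (u n \- a)) @ \oo --> (0 : R).

Definition weakly_cauchy (R : realType) (X : normedModType R)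
    (s : nat -> X) : Prop :=
  forall f : {linear X -> R^o}, continuous f ->
    cauchy ((fun n => f (s n) : R) @ \oo).

Definition wuC (R : realType) (X : normedModType R) (x : nat -> X) : Prop :=
  forall pi : nat -> nat, bijective pi -> weakly_cauchy (series (x \o pi)).

(* Main.v *)
From HB Require Import structures.
Require Import Defs.
From mathcomp Require Import all_boot all_order all_algebra.
From mathcomp Require Import all_classical all_reals all_analysis.
From mathcomp Require Import ring lra zify.

Import Order.TTheory GRing.Theory Num.Theory.

Set Implicit Arguments.
Unset Strict Implicit.
Unset Printing Implicit Defensive.

(* The series is wuC iff sum |f (x i)| < oo for every continuous functional f
   (if sum |u i| = oo for real u, gathering the terms of one sign inside
   successive blocks gives a rearrangement that is not Cauchy).  The finite sums
   sum a i *: x i with |a i| <= 1 are then weakly bounded, hence norm bounded by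
   some C.  So the partial sums of sum a i *: x i are C-Lipschitz in a for the
   sup norm, uniformly in the number of terms, and a uniform limit of
   N_theta-convergent sequences is N_theta-convergent: this gives completeness.
   Completeness yields c_0 through the finitely supported sequences.  Finally, if
   v i = |f (x i)| has partial sums S n -> oo, then
   a i = sg (f (x i)) / sqrt (1 + S i.+1) is in c_0 and
   sum_(i < n) a i * f (x i) >= sqrt (1 + S n) - 1 -> oo, so the block means of
   the distance of these sums to any point are unbounded, and a is not in
   S_Ntheta. *)

Local Open Scope classical_set_scope.
Local Open Scope ring_scope.


(** * The Hahn-Banach theorem and norming functionals *)

Section HahnBanach.
Context {R : realType} {X : normedModType R}.
Implicit Types (G : set (X * R)) (p q : X * R).

(** A partial linear functional is encoded by its graph, so that Zorn's lemma runs over sets ordered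
    by inclusion. Domination by the norm at [0] already forces such a graph to be single-valued. *)
Definition norm_dominated_graph G : Prop :=
  (forall (a : R) p q, G p -> G q -> G (a *: p.1 + q.1, a * p.2 + q.2)) /\
  (forall p, G p -> p.2 <= `|p.1|).

Lemma dominated_graphZ G a p : norm_dominated_graph G -> G p ->
  G (a *: p.1, a * p.2).
Proof.
move=> [lin _] Gp; have := lin (a - 1) p p Gp Gp.
by rewrite scalerBl scale1r subrK mulrBl mul1r subrK.
Qed.

(** The new value at [v] has to lie between all [p.2 - |p.1 - v|] and all [|q.1 + v| - q.2]; the
    triangle inequality separates the two families. Rescaling by [|t|^-1] reduces the other
    multiples of [v] to these bounds. *)
Lemma dominated_graph_extend G v : norm_dominated_graph G -> G !=set0 ->
  exists c, norm_dominated_graph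
    [set p | exists q t, G q /\ p = (q.1 + t *: v, q.2 + t * c)].
Proof.
move=> dG [p0 Gp0]; have [lin dom] := dG.
pose E := [set p.2 - `|p.1 - v| | p in G].
have ubE q : G q -> ubound E (`|q.1 + v| - q.2).
  move=> Gq _ [p Gp <-]; rewrite lerBrDr addrAC lerBlDr.
  have := dom _ (lin 1 p q Gp Gq); rewrite /= scale1r mul1r => /le_trans; apply.
  by rewrite [leRHS]addrC -[in leLHS](subrK v p.1) -addrA [v + _]addrC ler_normD.
have [E0 Eub] : E !=set0 /\ has_ubound E.
  by split; [exists (p0.2 - `|p0.1 - v|), p0|exists (`|p0.1 + v| - p0.2); exact: ubE].
have ge_c p : G p -> p.2 - `|p.1 - v| <= sup E.
  by move=> Gp; apply: ub_le_sup => //; exists p.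
have le_c q : G q -> sup E <= `|q.1 + v| - q.2.
  by move=> Gq; apply: ge_sup => //; exact: ubE.
exists (sup E); split=> [a _ _ [q [t [Gq ->]]] [q' [t' [Gq' ->]]]|_ [q [t [Gq ->]]]] /=.
  exists (a *: q.1 + q'.1, a * q.2 + q'.2), (a * t + t'); split; first exact: lin.
  by congr pair => /=; [rewrite scalerDr scalerDl scalerA addrACA|ring].
have [t0|t0|->] := ltgtP t 0; last by rewrite mul0r scale0r !addr0; exact: dom.
- have s0 : 0 < - t by rewrite oppr_gt0.
  have /= := ge_c _ (dominated_graphZ ((- t)^-1) dG Gq).
  have -> : (- t)^-1 *: q.1 - v = (- t)^-1 *: (q.1 + t *: v).
    by rewrite scalerDr scalerA invrN mulNr mulVf ?lt_eqF// scaleN1r.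
  rewrite normrZ gtr0_norm ?invr_gt0// -mulrBr mulrC ler_pdivrMr//; lra.
- have /= := le_c _ (dominated_graphZ t^-1 dG Gq).
  have -> : t^-1 *: q.1 + v = t^-1 *: (q.1 + t *: v).
    by rewrite scalerDr scalerA mulVf ?gt_eqF// scale1r.
  rewrite normrZ gtr0_norm ?invr_gt0// -mulrBr mulrC ler_pdivlMr//; lra.
Qed.

Lemma maximal_dominated_graph y : exists G,
  [/\ norm_dominated_graph G, G (y, `|y|) & forall v, exists r, G (v, r)].
Proof.
pose G0 : set (X * R) := [set (t *: y, t * `|y|) | t in [set: R]].
have dG0 : norm_dominated_graph G0.
  split=> [a _ _ [t _ <-] [t' _ <-]|_ [t _ <-]] /=.
    by exists (a * t + t') => //=; rewrite scalerDl scalerA mulrDl mulrA.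
  by rewrite normrZ ler_wpM2r// ler_norm.
have G0y : G0 (y, `|y|) by exists 1 => //; rewrite scale1r mul1r.
(* The union of the empty chain must satisfy [P], whence the guard [G !=set0]. *)
pose P G := norm_dominated_graph G /\ (G !=set0 -> G0 `<=` G).
have [F FP Ftot|G [[dG G0G] maxG]] := @Zorn_bigcup _ P.
  split; first split.
  - move=> a p q [A FA Ap] [B FB Bq].
    have [AB|BA] := Ftot _ _ FA FB.
      by exists B => //; apply: (FP _ FB).1.1 => //; exact: AB.
    by exists A => //; apply: (FP _ FA).1.1 => //; exact: BA.
  - by move=> p [A FA Ap]; exact: (FP _ FA).1.2.
  - move=> [p [A FA Ap]] q G0q; exists A => //.
    by apply: (FP _ FA).2 => //; exists p.
have Gn0 : G !=set0.
  apply/set0P/negP => /eqP G_eq0; apply: (maxG G0); last by split=> // _ ?.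
  by rewrite G_eq0; split=> // /(_ _ G0y).
exists G; split=> [//||v]; first exact: (G0G Gn0).
have [c dG'] := dominated_graph_extend v dG Gn0.
set G' := (X in norm_dominated_graph X) in dG'.
have GG' : G `<=` G'.
  by move=> [p r] Gp; exists (p, r), 0; split => //=; rewrite scale0r mul0r !addr0.
exists c; apply: contrapT => nG; apply: (maxG G').
  split=> // G'G; apply/nG/G'G.
  have G00 : G (0, 0).
    by have [p Gp] := Gn0; have := dominated_graphZ 0 dG Gp; rewrite scale0r mul0r.
  by exists (0, 0), 1; split => //=; rewrite scale1r mul1r !add0r.
by split=> // _; exact: subset_trans (G0G Gn0) GG'.
Qed.

Lemma norming_functional (y : X) : exists f : {linear X -> R^o},
  (forall z, `|f z| <= `|z|) /\ f y = `|y|.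
Proof.
have [G [dG Gy totG]] := maximal_dominated_graph y.
have [lin dom] := dG.
have uniqG v r s : G (v, r) -> G (v, s) -> r = s.
  move=> Gr Gs; have le r' s' : G (v, r') -> G (v, s') -> r' <= s'.
    move=> Gr' Gs'; have := dom _ (lin (-1) _ _ Gs' Gr').
    by rewrite /= scaleN1r addNr normr0 mulN1r addrC subr_le0.
  by apply/eqP; rewrite eq_le !le.
pose f v : R^o := projT1 (cid (totG v)).
have Gf v : G (v, f v) by rewrite /f; case: cid.
have flin : linear f.
  by move=> a u v; apply: uniqG (Gf _) _; exact: (lin a _ _ (Gf u) (Gf v)).
pose F : {linear X -> R^o} := HB.pack f (GRing.isLinear.Build R X R^o *:%R f flin).
exists F; split=> [z|]; last exact: uniqG (Gf y) Gy.
have h := dom _ (Gf z); have := dom _ (dominated_graphZ (-1) dG (Gf z)).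
by rewrite /= scaleN1r normrN mulN1r ler_norml lerNl h => ->.
Qed.

End HahnBanach.


Lemma cauchy_seq_cvgn {R : realType} {V : completeNormedModType R} (s : nat -> V) :
  (forall e : R, 0 < e -> exists N, forall n, (N <= n)%N -> `|s n - s N| < e) ->
  cvgn s.
Proof.
move=> H; apply/cauchy_cvgP/cauchy_exP => e e0; have [N hN] := H e e0.
by exists (s N), N => // n /= Nn; rewrite -ball_normE /= distrC; exact: hN.
Qed.

(** * Uniform boundedness by a gliding hump *)

Section WeaklyBounded.
Context {R : realType} {X : normedModType R}.

Lemma lipschitz_functional_continuous (f : {linear X -> R^o}) (C : R) :
  (forall z, `|f z| <= C * `|z|) -> continuous f.
Proof.
move=> fC; apply/linear_bounded_continuous/linear_boundedP.
by near=> r => z; apply: le_trans (fC z) _; apply: ler_wpM2r.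
Unshelve. all: by end_near. Qed.

(* Gliding hump: for an unbounded A pick y n in A with |y n| > 2n 3^n and put
   f = sum +- 3^-n h n, with h n norming y n and the sign chosen so that the n-th
   term does not decrease |f (y n)|.  The later terms contribute at most
   3^-n |y n| / 2, so f is unbounded on A. *)
Lemma weakly_bounded_bounded (A : set X) :
  (forall f : {linear X -> R^o}, continuous f ->
     exists M : R, forall y, A y -> `|f y| <= M) ->
  exists M : R, forall y, A y -> `|y| <= M.
Proof.
move=> wb; apply: contrapT => unb.
have /choice[y yP] (n : nat) : exists y, A y /\ n%:R * 2 * 3 ^+ n < `|y|.
  apply: contrapT => h; apply: unb; exists (n%:R * 2 * 3 ^+ n) => y Ay.
  by rewrite leNgt; apply/negP => My; apply: h; exists y.
have /choice[h hP] n := norming_functional (y n).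
pose c n : R := 3^-1 ^+ n.
have cS n : c n.+1 = c n / 3 by rewrite /c exprSr.
have c0 n : 0 < c n by rewrite exprn_gt0// invr_gt0.
pose F := fix F n : X -> R := if n is m.+1 then
  fun z => F m z + (if 0 <= F m (y m) then c m else - c m) * h m z else fun=> 0.
have Flin n a u v : F n (a *: u + v) = a * F n u + F n v.
  elim: n => /= [|n ->]; first by rewrite mulr0 addr0.
  by rewrite linearP /= /GRing.scale /=; ring.
have Fstep n z : `|F n.+1 z - F n z| <= c n * `|z|.
  rewrite /= addrC addKr normrM.
  have -> : `|(if 0 <= F n (y n) then c n else - c n)| = c n.
    by case: ifP => _; rewrite ?normrN gtr0_norm.
  by apply: ler_wpM2l; [exact: ltW|exact: (hP n).1].
have Fy n : c n * `|y n| <= `|F n.+1 (y n)|.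
  rewrite /= (hP n).2; have : 0 <= c n * `|y n| by rewrite mulr_ge0// ltW.
  have [F0 cy|F0 cy] := leP 0 (F n (y n)).
    by rewrite ger0_norm ?addr_ge0// lerDr.
  rewrite ltr0_norm; last by lra.
  by lra.
(* Geometric sum: [c n + ... + c (n + k - 1) = 3 / 2 * (c n - c (n + k))]. *)
have Ftail n k z : `|F (n + k)%N z - F n z| <= 3 / 2 * (c n - c (n + k)%N) * `|z|.
  elim: k => [|k IH]; first by rewrite addn0 !subrr normr0 mulr0 mul0r.
  rewrite addnS; move: IH (Fstep (n + k)%N z); rewrite cS.
  have := ler_distD (F (n + k)%N z) (F (n + k).+1 z) (F n z).
  set a := `|_|; set b := `|_|; set d := `|F _ _ - F n z|; lra.
have Ftail' n m z : (n <= m)%N -> `|F m z - F n z| <= 3 / 2 * c n * `|z|.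
  move=> nm; have := Ftail n (m - n)%N z; rewrite subnKC// => /le_trans; apply.
  by rewrite ler_wpM2r// ler_pM2l// gerBl ltW.
have Fcvg z : cvgn (F ^~ z).
  apply: (@cauchy_seq_cvgn R R^o) => e e0.
  have : geometric (3 / 2 * `|z|) (3^-1 : R) @ \oo --> (0 : R).
    by apply: cvg_geometric; rewrite gtr0_norm ?invr_gt0// invf_lt1// ltr1n.
  move=> /cvgrPdistC_lt/(_ _ e0)[N _ /(_ N (leqnn N))] /= hN.
  exists N => n Nn; apply: le_lt_trans hN.
  by rewrite subr0 (le_trans _ (ler_norm _))// mulrAC; exact: Ftail'.
pose f z : R^o := limn (F ^~ z).
have flin : linear f.
  move=> a u v; apply: cvg_lim => //.
  have -> : F ^~ (a *: u + v) = (fun n => a * F n u + F n v) by apply/funext => n.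
  by apply: cvgD; [apply: cvgMr; exact: Fcvg|exact: Fcvg].
have ftail n z : `|f z - F n z| <= 3 / 2 * c n * `|z|.
  have cv : (fun m => `|F m z - F n z|) @ \oo --> `|f z - F n z|.
    by apply: cvg_norm; apply: cvgB (Fcvg z) _; exact: cvg_cst.
  rewrite -(cvg_lim _ cv)//; apply: limr_le; first by apply/cvg_ex; eexists; exact: cv.
  by exists n => // m /= nm; exact: Ftail'.
pose G : {linear X -> R^o} := HB.pack f (GRing.isLinear.Build R X R^o *:%R f flin).
have /(lipschitz_functional_continuous (f := G)) /wb[M hM] z : `|f z| <= 3 / 2 * `|z|.
  by have := ftail 0%N z; rewrite /= subr0 /c expr0 mulr1.
(* With [n > |M|], the terms after the [n]-th cost at most half of [c n * |y n|], so
   [|f (y n)| >= c n * |y n| / 2 > n > |M|]. *)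
have := archi_boundP (normr_ge0 M); set n := Num.bound _ => Mn.
have := hM _ (yP n).1; have := ftail n.+1 (y n); have := Fy n.
have := (yP n).2; rewrite cS => yn.
have : n%:R * 2 < c n * `|y n|.
  by rewrite /c exprVn [ltRHS]mulrC ltr_pdivlMr ?exprn_gt0.
have := ler_norm M.
have := ler_normB (f (y n)) (f (y n) - F n.+1 (y n)); rewrite subKr.
set a := `|y n|; set b := `|F _ _|; lra.
Qed.

End WeaklyBounded.


(** * Rearrangements of real series *)

Lemma strictly_increasing_geq (b : nat -> nat) :
  (forall k, (b k < b k.+1)%N) -> forall k, (k <= b k)%N.
Proof. by move=> bS; elim=> // k /leq_ltn_trans; exact. Qed.

(** The blocks [[b k, b k.+1)] partition [nat], so permutations of the single blocks glue together.
    [K i] is the block of [i]; the inverse looks up the position of [j] in [s (K j)]. *)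
Lemma blockwise_bijection (b : nat -> nat) (s : nat -> seq nat) :
  b 0%N = 0%N -> (forall k, (b k < b k.+1)%N) ->
  (forall k, perm_eq (s k) (index_iota (b k) (b k.+1))) ->
  exists2 pi, bijective pi &
    forall k i, (i < size (s k))%N -> pi (b k + i)%N = nth 0%N (s k) i.
Proof.
move=> b0 bS sP.
have bmono : {homo b : m n / (m <= n)%N}.
  by apply: homo_leq => // [m n p|k]; [exact: leq_trans|exact: ltnW].
have size_s k : size (s k) = (b k.+1 - b k)%N.
  by rewrite (perm_size (sP k)) size_iota.
have /choice[K KP] i : exists k, (b k <= i < b k.+1)%N.
  elim: i => [|i [k /andP[ki ik]]]; first by exists 0%N; rewrite b0 -[X in (X < _)%N]b0 bS.
  have [ik'|ik'] := ltnP i.+1 (b k.+1); first by exists k; rewrite ik' (leqW ki).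
  by exists k.+1; rewrite ik' (leq_ltn_trans ik (bS _)).
have Kuniq i k : (b k <= i < b k.+1)%N -> K i = k.
  move=> /andP[ki ik]; have /andP[Ki iK] := KP i.
  by case: (ltngtP (K i) k) => // /bmono; lia.
have mem_s k j : (j \in s k) = (b k <= j < b k.+1)%N.
  by rewrite (perm_mem (sP k)) mem_index_iota.
have uniq_s k : uniq (s k) by rewrite (perm_uniq (sP k)) iota_uniq.
pose pi i := nth 0%N (s (K i)) (i - b (K i)).
pose pinv j := (b (K j) + index j (s (K j)))%N.
have ltK i : (i - b (K i) < size (s (K i)))%N.
  by rewrite size_s; have := KP i; lia.
have piE k i : (i < size (s k))%N -> pi (b k + i)%N = nth 0%N (s k) i.
  move=> ik; rewrite /pi (Kuniq _ k) ?addKn//.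
  by move: ik; rewrite size_s; lia.
exists pi => //; exists pinv => i.
  have Kpi : K (pi i) = K i by apply: Kuniq; rewrite -mem_s mem_nth.
  by rewrite /pinv Kpi index_uniq// subnKC//; case/andP: (KP i).
have iK : i \in s (K i) by rewrite mem_s.
by rewrite piE ?index_mem// nth_index.
Qed.

Section Rearrangement.
Context {R : realType}.
Implicit Types u : nat -> R.

Lemma rearrangement_positive_part u :
  (forall pi, bijective pi -> cvgn (series (u \o pi))) ->
  exists M, forall n, \sum_(0 <= i < n | 0 < u i) u i <= M.
Proof.
move=> cvgu; apply: contrapT => unb.
(* [g N] closes a block starting at [N] whose positive terms add up to at least [1]. *)
have /choice[g gP] N :
    exists n, (N < n)%N /\ 1 <= \sum_(N <= i < n | 0 < u i) u i.
  apply: contrapT => h; apply: unb.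
  exists (\sum_(0 <= i < N | 0 < u i) u i + 1) => n.
  have [nN|Nn] := leqP n N.
    rewrite (big_cat_nat (leq0n n) nN)//= -addrA lerDl addr_ge0// sumr_ge0// => i /ltW //.
  rewrite (big_cat_nat (leq0n N) (ltnW Nn))//= lerD2l leNgt; apply/negP => lt1.
  by apply: h; exists n; rewrite ltW.
pose b k := iter k g 0%N.
have bS k : (b k < b k.+1)%N by exact: (gP _).1.
pose I k := index_iota (b k) (b k.+1).
pose pos k := [seq i <- I k | 0 < u i].
(* Each block is rearranged with its positive terms first. *)
have [] := @blockwise_bijection b (fun k => pos k ++ [seq i <- I k | ~~ (0 < u i)]).
- by [].
- exact: bS.
- by move=> k; rewrite perm_filterC.
move=> pi pi_bij piE; have half_gt0 : 0 < 1 / 2 :> R by rewrite divr_gt0.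
have /cvgrPdist_lt/(_ _ half_gt0)[N _ hN] := cvgu pi pi_bij.
(* The rearranged partial sums at [b N] and [b N + p] differ by at least [1], though both are within
   [1 / 2] of the limit. *)
pose p := size (pos N).
have Nb := strictly_increasing_geq bS N.
have := hN _ Nb; have := hN _ (leq_trans Nb (leq_addr p _)).
have -> : series (u \o pi) (b N + p)%N =
    series (u \o pi) (b N) + \sum_(b N <= i < b N.+1 | 0 < u i) u i.
  rewrite /series /= (big_cat_nat (leq0n _) (leq_addr p _))//=; congr (_ + _).
  rewrite -{1}[b N]add0n big_addn addKn -[RHS]big_filter [RHS](big_nth 0%N).
  apply: eq_big_nat => i /andP[_ ip] /=; rewrite addnC piE.
    by rewrite nth_cat ip.
  by rewrite size_cat ltn_addr.
have := (gP (b N)).2; rewrite -/(b N.+1) /=.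
set t := \sum_(_ <= _ < _ | _) _; set l := limn _; set v := series _ _.
rewrite !ltr_norml => t1 /andP[? ?] /andP[? ?]; lra.
Qed.

(** The negative part of [u] is the positive part of [- u], whose rearrangements converge as
    well. *)
Lemma unconditionally_convergent_abs_bounded u :
  (forall pi, bijective pi -> cvgn (series (u \o pi))) ->
  exists M, forall n, \sum_(0 <= i < n) `|u i| <= M.
Proof.
move=> cvgu; have [M1 hM1] := rearrangement_positive_part cvgu.
have [|M2 hM2] := @rearrangement_positive_part (fun i => - u i).
  by move=> pi /cvgu; rewrite -is_cvgNE -seriesN.
exists (M1 + M2) => n; apply: le_trans (lerD (hM1 n) (hM2 n)).
rewrite [X in X + _]big_mkcond [X in _ + X]big_mkcond -big_split /=; apply: ler_sum => i _.
rewrite oppr_gt0; case: (ltgtP (u i) 0) => [u0|u0|->].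
- by rewrite ltr0_norm// add0r.
- by rewrite gtr0_norm// addr0.
- by rewrite normr0 addr0.
Qed.

End Rearrangement.


(** * Bounded sequences and the supremum norm *)

Section SupNorm.
Context {R : realType}.
Implicit Types (a b : nat -> R).

Lemma linftyP a : linfty a <-> exists M : R, forall i, `|a i| <= M.
Proof.
split=> [/pinfty_ex_gt0[M _ aM]|[M aM]]; first by exists M => i; exact: aM.
by exists M; split; [exact: num_real|move=> r /ltW Mr i _; exact: le_trans (aM i) Mr].
Qed.

Lemma linftyB a b : linfty a -> linfty b -> linfty (a \- b).
Proof.
move=> /linftyP[M aM] /linftyP[N bN]; apply/linftyP; exists (M + N) => i /=.
by rewrite (le_trans (ler_normB _ _))// lerD.
Qed.

Lemma c0_linfty a : c0 a -> linfty a.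
Proof.
move=> a0; have /pinfty_ex_gt0[M _ aM] : bounded_fun (a : nat -> R^o).
  by apply: cvg_seq_bounded; apply/cvg_ex; exists 0; exact: a0.
by apply/linftyP; exists M => i; exact: aM.
Qed.

Lemma le_sup_norm a i : linfty a -> `|a i| <= sup_norm a.
Proof.
move=> /linftyP[M aM]; apply: ub_le_sup; last by exists i.
by exists M => _ [j _ <-].
Qed.

Lemma sup_norm_le a e : (forall i, `|a i| <= e) -> sup_norm a <= e.
Proof.
by move=> ae; apply: ge_sup => [|_ [j _ <-] //]; exists `|a 0%N|, 0%N.
Qed.

Lemma sup_norm_ge0 a : linfty a -> 0 <= sup_norm a.
Proof. by move=> /(le_sup_norm 0) /(le_trans _); apply. Qed.

End SupNorm.

(** * Block means and lacunary strong convergence *)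

Section BlockMean.
Context {R : realType} {X : normedModType R}.
Variable theta : nat -> nat.
Hypothesis htheta : lacunary theta.
Implicit Types (u v : nat -> R) (s t : nat -> X) (L M : X).

(** [lacunary_mean theta s L r] unfolds to this mean at [u k = |s k - L|]; a general [u] makes
    linearity and monotonicity available. *)
Definition block_mean u r : R :=
  (gap theta r)%:R^-1 * \sum_((theta r.-1).+1 <= k < (theta r).+1) u k.

Lemma block_mean_le u v r : (forall k, (theta r.-1 < k)%N -> u k <= v k) ->
  block_mean u r <= block_mean v r.
Proof.
move=> uv; rewrite ler_wpM2l// ?invr_ge0//.
by apply: ler_sum_nat => k /andP[rk _]; exact: uv.
Qed.

Lemma block_meanD u v r :
  block_mean (u \+ v) r = block_mean u r + block_mean v r.
Proof. by rewrite -mulrDr -big_split. Qed.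

Lemma block_meanZ (c : R) u r :
  block_mean (fun k => c * u k) r = c * block_mean u r.
Proof. by rewrite /block_mean -mulr_sumr mulrCA. Qed.

Lemma block_mean_cst (c : R) r : (0 < r)%N -> block_mean (fun=> c) r = c.
Proof.
case: htheta => _ thetaS _; case: r => // r _.
rewrite /block_mean big_const_nat iter_addr_0 subSS -/(gap theta r.+1).
by rewrite -[c *+ _]mulr_natl mulKf// pnatr_eq0 subn_eq0 -ltnNge thetaS.
Qed.

Lemma lacunary_mean_ge0 s L r : 0 <= lacunary_mean theta s L r.
Proof. by rewrite mulr_ge0 ?invr_ge0// sumr_ge0. Qed.

Lemma Ntheta_limP s L : Ntheta_lim theta s L <->
  forall e : R, 0 < e -> exists N, forall r, (N <= r)%N ->
    block_mean (fun k => `|s k - L|) r <= e.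
Proof.
split=> [/cvgrPdistC_le H e /H[N _ hN]|H].
  by exists N => r /hN /=; rewrite subr0 ger0_norm// lacunary_mean_ge0.
apply/cvgrPdistC_le => e /H[N hN]; exists N => // r /= /hN.
by rewrite subr0 ger0_norm// lacunary_mean_ge0.
Qed.

Lemma leq_theta r : (r <= theta r)%N.
Proof. by case: htheta => _ /strictly_increasing_geq. Qed.

Lemma cvgn_Ntheta_lim s L : s @ \oo --> L -> Ntheta_lim theta s L.
Proof.
move=> /cvgrPdistC_le sL; apply/Ntheta_limP => e /sL[N _ hN].
(* The shift to [N.+1] gives both [0 < r] and [N <= r.-1 <= theta r.-1]. *)
exists N.+1 => r Nr; rewrite -[leRHS](block_mean_cst _ (leq_trans _ Nr))//.
apply: block_mean_le => k rk; apply: hN => /=.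
by have := leq_theta r.-1; lia.
Qed.

(** For every [k], [|L - M| <= |s k - t k| + |s k - L| + |t k - M|]; averaging over a late block
    makes the last two terms small. *)
Lemma Ntheta_lim_dist s t L M e : (forall k, `|s k - t k| <= e) ->
  Ntheta_lim theta s L -> Ntheta_lim theta t M -> `|L - M| <= e.
Proof.
move=> ste /Ntheta_limP sL /Ntheta_limP tM; apply/ler_addgt0Pr => d d0.
have d2 : 0 < d / 2 by rewrite divr_gt0.
have [N hN] := sL _ d2; have [N' hN'] := tM _ d2.
pose r := (maxn N N').+1.
have {hN}hs := hN r (leqW (leq_maxl _ _)).
have {hN'}ht := hN' r (leqW (leq_maxr _ _)).
rewrite -[leLHS](@block_mean_cst _ r)//.
apply: (@le_trans _ _ (block_mean (((fun k => `|s k - L|) \+ (fun k => `|t k - M|)) \+ (fun=> e)) r)).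
  apply: block_mean_le => k _ /=.
  have -> : L - M = (s k - t k) - ((s k - L) - (t k - M)).
    have -> : s k - L - (t k - M) = s k - t k - (L - M) by rewrite !opprD addrACA.
    by rewrite subKr.
  have := ler_normB (s k - t k) ((s k - L) - (t k - M)).
  have := ler_normB (s k - L) (t k - M); have := ste k; lra.
by rewrite !block_meanD block_mean_cst//; lra.
Qed.

End BlockMean.

Section UniformLimit.
Context {R : realType} {X : completeNormedModType R}.

(** The limits [L n] are Cauchy by [Ntheta_lim_dist], so completeness of [X] provides [M]; then
    [|t k - M|] is compared with [|s n k - L n|] for one large [n] and averaged. *)
Lemma Ntheta_lim_uniform (theta : nat -> nat) (s : nat -> nat -> X)
    (t : nat -> X) (L : nat -> X) : lacunary theta ->
  (forall n, Ntheta_lim theta (s n) (L n)) ->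
  (forall e : R, 0 < e -> exists N, forall n k, (N <= n)%N -> `|s n k - t k| <= e) ->
  exists M, Ntheta_lim theta t M.
Proof.
move=> htheta sL st.
have Lcauchy e N m n : (forall n k, (N <= n)%N -> `|s n k - t k| <= e) ->
    (N <= m)%N -> (N <= n)%N -> `|L m - L n| <= e + e.
  move=> hN Nm Nn; apply: (Ntheta_lim_dist htheta _ (sL m) (sL n)) => k.
  rewrite -(subrK (t k) (s m k)) -addrA (le_trans (ler_normD _ _))// lerD ?hN//.
  by rewrite distrC hN.
have : cvgn L.
  apply: cauchy_seq_cvgn => e e0.
  have e4 : 0 < e / 4 by rewrite divr_gt0.
  have [N hN] := st _ e4; exists N => n Nn.
  by have := Lcauchy _ _ _ _ hN Nn (leqnn N); lra.
move=> /cvg_ex[M LM]; exists M; apply/Ntheta_limP => e e0.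
have e4 : 0 < e / 4 by rewrite divr_gt0.
have [N hN] := st _ e4.
have [N' _ hN'] := (cvgrPdistC_le _ _).1 LM _ e4.
pose n := maxn N N'.
have [Nr hNr] := (Ntheta_limP _ _ _).1 (sL n) _ e4.
exists Nr.+1 => r Nrr.
apply: (@le_trans _ _ (block_mean theta ((fun k => `|s n k - L n|) \+ (fun=> e / 2)) r)).
  apply: block_mean_le => k _ /=.
  have := hN n k (leq_maxl _ _); have := hN' n (leq_maxr _ _).
  have := ler_distD (s n k) (t k) M; have := ler_distD (L n) (s n k) M.
  by rewrite [`|t k - s n k|]distrC /=; lra.
rewrite block_meanD block_mean_cst ?(leq_trans _ Nrr)//.
by have := hNr r (ltnW Nrr); lra.
Qed.

End UniformLimit.

(** * Weakly unconditionally Cauchy series and bounds on their finite sums *)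

Section Series.
Context {R : realType} {X : normedModType R}.
Implicit Types (x : nat -> X) (a : nat -> R).

Lemma continuous_functional_bound (f : {linear X -> R^o}) : continuous f ->
  exists2 C : R, 0 < C & forall z, `|f z| <= C * `|z|.
Proof.
by move=> /linear_bounded_continuous /linear_boundedP /pinfty_ex_gt0.
Qed.

Definition functionally_summable x : Prop :=
  forall f : {linear X -> R^o}, continuous f ->
    exists M : R, forall n, \sum_(0 <= i < n) `|f (x i)| <= M.

Lemma sum_injective_le (v : nat -> R) (M : R) (pi : nat -> nat) n :
  injective pi -> (forall i, 0 <= v i) ->
  (forall n, \sum_(0 <= i < n) v i <= M) -> \sum_(0 <= i < n) v (pi i) <= M.
Proof.
move=> pi_inj v0 vM.
pose s := [seq pi i | i <- index_iota 0 n].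
pose N := (\max_(j <- s) j).+1.
have sN j : j \in s -> (j < N)%N by move=> js; rewrite ltnS (leq_bigmax_seq (F := id)).
apply: le_trans (vM N); rewrite -(big_map pi xpredT v) -/s.
have -> : \sum_(j <- s) v j = \sum_(0 <= j < N | j \in s) v j.
  rewrite -[RHS]big_filter; apply: perm_big; apply: uniq_perm.
  - by rewrite map_inj_uniq// iota_uniq.
  - by rewrite filter_uniq// iota_uniq.
  move=> j; rewrite mem_filter mem_index_iota /=.
  by case: (boolP (j \in s)) => //= /sN.
by rewrite big_mkcond; apply: ler_sum => j _; case: ifP.
Qed.

Lemma linear_series (f : {linear X -> R^o}) (z : nat -> X) :
  (fun n => f (series z n)) = series (fun i => f (z i) : R).
Proof. by apply/funext => n; rewrite /series /= linear_sum. Qed.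

Lemma wuCP x : wuC x <-> functionally_summable x.
Proof.
split=> [wx f fc|fx pi pi_bij f fc].
  apply: unconditionally_convergent_abs_bounded => pi pi_bij.
  by have /cauchy_cvgP := wx pi pi_bij f fc; rewrite linear_series.
apply/cauchy_cvgP; rewrite linear_series.
apply: (@normed_cvg R R^o); have [M fM] := fx f fc.
apply: nondecreasing_is_cvgn; last first.
  exists M => _ [n _ <-]; rewrite /series /=.
  by apply: (@sum_injective_le (fun i => `|f (x i)|)) => //; exact: bij_inj.
by move=> m n mn; apply: nondecreasing_series mn => i _ _ /=; exact: normr_ge0.
Qed.

(** For coefficients of modulus at most [1], [|f|] of a finite sum is at most a sum of [|f (x i)|],
    so these finite sums form a weakly bounded set. Homogeneity gives general [e > 0]. *)
Lemma functionally_summable_bound x : functionally_summable x ->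
  exists2 C : R, 0 < C & forall m n a e, 0 <= e ->
    (forall i, (m <= i < n)%N -> `|a i| <= e) ->
    `|\sum_(m <= i < n) a i *: x i| <= C * e.
Proof.
move=> fx; pose A := [set y | exists m n a,
  (forall i, (m <= i < n)%N -> `|a i| <= 1) /\ y = \sum_(m <= i < n) a i *: x i].
have [f fc|C AC] := @weakly_bounded_bounded R X A.
  have [M fM] := fx f fc; exists M => _ [m [n [a [a1 ->]]]].
  rewrite linear_sum; apply: le_trans (ler_norm_sum _ _ _) _.
  apply: le_trans (fM n).
  have [mn|/ltnW nm] := leqP m n; last by rewrite big_geq// sumr_ge0.
  rewrite [leRHS](big_cat_nat (leq0n m) mn)/= ler_wpDl ?sumr_ge0//.
  apply: ler_sum_nat => i /a1 ai; rewrite linearZ normrM.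
  by rewrite ler_piMl.
(* The added [1] makes the constant positive, so that it can be divided by later. *)
exists (`|C| + 1) => [|m n a e]; first by rewrite ltr_wpDl.
rewrite le0r => /predU1P[->|e0] ae.
  rewrite big_nat big1 ?normr0 ?mulr0// => i /ae.
  by rewrite normr_le0 => /eqP ->; rewrite scale0r.
have -> : \sum_(m <= i < n) a i *: x i = e *: \sum_(m <= i < n) (a i / e) *: x i.
  by rewrite scaler_sumr; apply: eq_bigr => i _; rewrite scalerA mulrC divfK// gt_eqF.
rewrite normrZ gtr0_norm// mulrC ler_pM2r//.
apply: (@le_trans _ _ C); last by rewrite (le_trans (ler_norm C))// lerDl.
apply: AC; exists m, n, (fun i => a i / e); split=> // i /ae aie.
by rewrite normrM normfV (gtr0_norm e0) ler_pdivrMr// mul1r.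
Qed.

End Series.


(** * Null weights that preserve divergence *)

Section Divergence.
Context {R : realType}.

Lemma partial_sums_unbounded (v : nat -> R) : (forall i, 0 <= v i) ->
  ~ (exists M, forall n, \sum_(0 <= i < n) v i <= M) ->
  forall B, exists N, forall n, (N <= n)%N -> B <= \sum_(0 <= i < n) v i.
Proof.
move=> v0 unb B; apply: contrapT => h; apply: unb; exists B => N.
rewrite leNgt; apply/negP => BN; apply: h; exists N => n Nn.
apply: le_trans (ltW BN) _; rewrite (big_cat_nat (leq0n N) Nn)/=.
by rewrite lerDl sumr_ge0.
Qed.

Definition damping (v : nat -> R) (i : nat) : R :=
  (Num.sqrt (1 + \sum_(0 <= j < i.+1) v j))^-1.

Lemma damping_c0 (v : nat -> R) : (forall i, 0 <= v i) ->
  ~ (exists M, forall n, \sum_(0 <= i < n) v i <= M) -> c0 (damping v).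
Proof.
move=> v0 unb; apply/cvgrPdistC_le => e e0.
(* Sums above [e^-2] have square root above [e^-1]. *)
have [N hN] := partial_sums_unbounded v0 unb (e^-1 ^+ 2).
exists N => // n /= Nn; rewrite subr0 /damping normfV ger0_norm ?sqrtr_ge0//.
have S_gt0 : 0 < 1 + \sum_(0 <= j < n.+1) v j by rewrite ltr_pwDl ?sumr_ge0.
have e'0 : 0 <= e^-1 by rewrite invr_ge0 ltW.
rewrite invf_ple ?posrE ?sqrtr_gt0// -[leLHS](ger0_norm e'0) -sqrtr_sqr ler_sqrt ?(ltW S_gt0)//.
by rewrite ler_wpDl// hN// leqW.
Qed.

(** Each weight with [i < n] is at least the one formed with the full sum [S], so the right side is
    at least [S / sqrt (1 + S)]; this dominates [sqrt (1 + S) - 1] because [sqrt (1 + S) >= 1]. *)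
Lemma damping_sum_ge (v : nat -> R) n : (forall i, 0 <= v i) ->
  Num.sqrt (1 + \sum_(0 <= i < n) v i) - 1 <= \sum_(0 <= i < n) damping v i * v i.
Proof.
move=> v0; set S := \sum_(0 <= i < n) v i.
have S0 : 0 <= S by exact: sumr_ge0.
have S1 : 0 < 1 + S by rewrite ltr_pwDl.
have q0 : 0 < Num.sqrt (1 + S) by rewrite sqrtr_gt0.
apply: (@le_trans _ _ ((Num.sqrt (1 + S))^-1 * S)); last first.
  rewrite mulr_sumr; apply: ler_sum_nat => i /andP[_ iN]; rewrite ler_wpM2r//.
  rewrite lef_pV2 ?posrE// ?sqrtr_gt0 ?ltr_pwDl ?sumr_ge0//.
  rewrite ler_sqrt ?(ltW S1)// lerD2l /S (big_cat_nat (leq0n i.+1) iN)/=.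
  by rewrite lerDl sumr_ge0.
rewrite mulrC ler_pdivlMr// mulrBl mul1r -expr2 sqr_sqrtr ?(ltW S1)//.
have : 1 <= Num.sqrt (1 + S) by rewrite -[leLHS]sqrtr1 ler_sqrt ?(ltW S1)// lerDl.
lra.
Qed.

End Divergence.

(** * The three implications *)

Section Characterization.
Context {R : realType} {X : completeNormedModType R}.
Variables (x : nat -> X) (theta : nat -> nat).
Hypothesis htheta : lacunary theta.

Lemma c0_summable_wuC : @c0 R `<=` S_Ntheta theta x -> wuC x.
Proof.
move=> c0S; apply/wuCP => f fc; apply: contrapT => unb.
pose v i := `|f (x i)|.
have v0 i : 0 <= v i by exact: normr_ge0.
pose a i := damping v i * Num.sg (f (x i)).
have dv0 i : 0 <= damping v i by rewrite invr_ge0 sqrtr_ge0.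
have [] : S_Ntheta theta x a.
  apply: c0S; apply/cvgrPdistC_le => e e0.
  have /cvgrPdistC_le/(_ e e0)[N _ hN] := damping_c0 v0 unb.
  exists N => // n /hN /=; rewrite !subr0; apply: le_trans.
  by rewrite /a normrM ler_piMr// normr_sg lern1 leq_b1.
move=> _ [L /Ntheta_limP/(_ 1 ltr01)[N hN]].
set s := series _ in hN.
have fs k : f (s k) = \sum_(0 <= i < k) damping v i * v i.
  rewrite /s /series /= linear_sum; apply: eq_bigr => i _.
  by rewrite linearZ /= /GRing.scale /= /a -mulrA -normrEsg.
have [C C0 fC] := continuous_functional_bound fc.
(* Once [sqrt (1 + S k) >= B], [|f (s k) - f L| >= C + 1]. Averaged over a late block this exceeds
   [C], while the block mean of [|s k - L|] is at most [1] and [|f z| <= C * |z|]. *)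
pose B : R := `|f L| + C + 2.
have [N' hN'] := partial_sums_unbounded v0 unb (B ^+ 2).
pose r := (maxn N N').+1.
have := hN r (leqW (leq_maxl _ _)).
have : C + 1 <= C * block_mean theta (fun k => `|s k - L|) r.
  rewrite -block_meanZ -[leLHS](block_mean_cst htheta _ (r := r))//.
  apply: block_mean_le => k rk; apply: le_trans (fC _).
  have Nk : (N' <= k)%N.
    have := leq_theta htheta r.-1; rewrite /r /= in rk *.
    by have := leq_maxr N N'; lia.
  have := damping_sum_ge k v0; rewrite -fs.
  have : B <= Num.sqrt (1 + \sum_(0 <= i < k) v i).
    have B0 : 0 <= B by rewrite !addr_ge0// ltW.
    rewrite -[leLHS]ger0_norm// -sqrtr_sqr ler_sqrt ?addr_ge0 ?sumr_ge0//.
    by rewrite ler_wpDl// hN'.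
  rewrite linearB /=; have := ler_norm (f (s k) - f L); have := ler_norm (f L).
  rewrite /B; lra.
by move=> h1 h2; have := ler_wpM2l (ltW C0) h2; lra.
Qed.

Lemma wuC_S_Ntheta_complete : wuC x -> sup_norm_complete (S_Ntheta theta x).
Proof.
move=> /wuCP /functionally_summable_bound[C C0 hC] u uS ucauchy.
have ub n : linfty (u n) := (uS n).1.
have ucauchy' e : 0 < e -> exists N, forall m n i, (N <= m)%N -> (N <= n)%N ->
    `|u m i - u n i| < e.
  move=> /ucauchy[N hN]; exists N => m n i Nm Nn; apply: le_lt_trans (hN m n Nm Nn).
  exact: (@le_sup_norm _ (u m \- u n) i (linftyB (ub m) (ub n))).
have /choice[a ua] i : exists l : R, (u ^~ i) @ \oo --> l.
  apply/cvg_ex; apply: (@cauchy_seq_cvgn R R^o) => e /ucauchy'[N hN].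
  by exists N => n Nn; exact: hN.
(* The index [N'] depends on [i], but it enters only through the intermediate term
   [u (maxn N N') i]; [N] is uniform in [i]. *)
have unif e : 0 < e -> exists N, forall n i, (N <= n)%N -> `|u n i - a i| <= e.
  move=> e0; have e2 : 0 < e / 2 by rewrite divr_gt0.
  have [N hN] := ucauchy' _ e2; exists N => n i Nn.
  have [N' _ hN'] := (cvgrPdistC_le _ _).1 (ua i) _ e2.
  have := hN' _ (leq_maxr N N'); have := hN n _ i Nn (leq_maxl N N').
  by have := ler_distD (u (maxn N N') i) (u n i) (a i); rewrite /=; lra.
have ab : linfty a.
  have [N hN] := unif 1 ltr01; have /linftyP[M uM] := ub N.
  apply/linftyP; exists (M + 1) => i.
  have := uM i; have := hN N i (leqnn _).
  by have := ler_normB (u N i) (u N i - a i); rewrite subKr; lra.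
exists a; last first.
  apply/cvgrPdistC_le => e /unif[N hN]; exists N => // n /= Nn.
  rewrite subr0 ger0_norm; last exact: sup_norm_ge0 (linftyB (ub n) ab).
  by apply: sup_norm_le => i; exact: hN.
split=> //; have /choice[L hL] n := (uS n).2.
apply: (Ntheta_lim_uniform htheta hL) => e e0.
have eC : 0 < e / C by rewrite divr_gt0.
have [N hN] := unif _ eC; exists N => n k Nn.
have -> : series (fun i => u n i *: x i) k - series (fun i => a i *: x i) k =
    \sum_(0 <= i < k) (u n i - a i) *: x i.
  by rewrite /series /= -sumrB; apply: eq_bigr => i _; rewrite scalerBl.
have -> : e = C * (e / C) by rewrite mulrC divfK// gt_eqF.
by apply: hC => [|i _]; [exact: ltW|exact: hN].
Qed.

Lemma complete_c0_subset :
  sup_norm_complete (S_Ntheta theta x) -> @c0 R `<=` S_Ntheta theta x.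
Proof.
move=> complete a a0.
have aB : linfty a := c0_linfty a0.
(* The truncations of [a] give eventually constant partial sums, and they are Cauchy in the supremum
   norm because [a] tends to [0]. *)
pose u n i := if (i < n)%N then a i else 0.
have uB n : linfty (u n).
  have /linftyP[M aM] := aB; apply/linftyP; exists M => i; rewrite /u.
  by case: ifP => // _; rewrite normr0 (le_trans _ (aM 0%N)).
have uS n : S_Ntheta theta x (u n).
  split=> //; exists (series (fun i => u n i *: x i) n).
  apply: cvgn_Ntheta_lim => //; apply: cvg_near_cst.
  exists n => // k /= nk; rewrite /series /= (big_cat_nat (leq0n n) nk)/=.
  rewrite [X in _ + X]big_nat [X in _ + X]big1 ?addr0// => i /andP[ni _].
  by rewrite /u ltnNge ni scale0r.
have [e e0|b bS ub] := complete u uS.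
  have e2 : 0 < e / 2 by rewrite divr_gt0.
  have [N _ hN] := (cvgrPdistC_le _ _).1 a0 _ e2.
  exists N => m n Nm Nn; apply: (@le_lt_trans _ _ (e / 2)); last by lra.
  apply: sup_norm_le => i /=; rewrite /u.
  have [iN|Ni] := ltnP i N.
    by rewrite !(leq_trans iN)// subrr normr0 ltW.
  have := hN i Ni; rewrite /= subr0 => ai.
  by case: ifP; case: ifP; rewrite ?subrr ?subr0 ?sub0r ?normrN ?normr0// ltW.
(* For [n > i] the truncation [u n] agrees with [a] at [i], so [|a i - b i| <= sup_norm (u n \- b)],
   which tends to [0]. *)
suff -> : a = b by [].
apply/funext => i; apply/eqP; rewrite -subr_eq0 -normr_le0.
apply/ler_addgt0Pr => e e0; rewrite add0r.
have [N _ hN] := (cvgrPdistC_le _ _).1 ub _ e0.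
have := hN _ (leq_maxl N i.+1); rewrite /= subr0; apply: le_trans.
apply: le_trans (ler_norm _).
have := @le_sup_norm _ _ i (linftyB (uB (maxn N i.+1)) bS.1).
by rewrite /= /u leq_maxr.
Qed.

End Characterization.

Theorem theorem4p1 (R : realType) (X : completeNormedModType R)
    (x : nat -> X) (theta : nat -> nat) (htheta : lacunary theta) :
  (wuC x <-> sup_norm_complete (S_Ntheta theta x)) /\
  (sup_norm_complete (S_Ntheta theta x) <-> @c0 R `<=` S_Ntheta theta x).
Proof.
have wuC_complete := wuC_S_Ntheta_complete htheta (x := x).
have complete_c0 := complete_c0_subset htheta (x := x).
have c0_wuC := c0_summable_wuC htheta (x := x).
split; split.
- exact: wuC_complete.
- by move=> /complete_c0/c0_wuC.
- exact: complete_c0.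
- by move=> /c0_wuC/wuC_complete.
Qed.
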